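(* Let $d\ge2$ be a nonsquare integer with fundamental solution $(X_1,Y_1)$ of $x^2-dy^2=1$. Let $K>X_1$ be an integer and let $w$ be a positive integer with $2^w\ge d^2K^4$. Then Program QC (defined in the context), on input $d,K,w$, returns $(X_1,Y_1)$. Its packed integer $M$ has at most $2w(2K+1)K^3$ binary digits. All intermediates outside the Hamming-weight subroutine have $O(wK^4)$ binary digits.
   Context: The fundamental solution is the solution of $x^2-dy^2=1$ in positive integers with $X_1$ least. All values are in $\mathbb N=\{0,1,2,\dots\}$; $u\mathbin{\dot{-}}v=\max(u-v,0)$; $u\bmod v$ is the remainder; divisors are positive. The constants implied by $O(\cdot)$ are absolute. Intermediates are all values computed while evaluating the assignments; those ''outside the Hamming-weight subroutine'' are all except the ones computed inside the call $\mathsf H(M)$ below. Subroutine $\mathsf G_{024}(Q,K,t)$ returns $(G_0,G_2,G_4)$ computed by: $u=Q\mathbin{\dot{-}}1$, $Z_Q=Q^K$, $v=ut$, $Q_+=Q+1$, $u_3=u^3$, $G_0=\lfloor Z_Q/u\rfloor$, $z=v\mathbin{\dot{-}}2$, $g_2=vz+Q_+$, $G_2=\lfloor Z_Qg_2/u_3\rfloor$, $u_5=u^5$, $h=Q_+(Q+9)$, $g_4=g_2g_2+Q\bigl((4v)(z\mathbin{\dot{-}}Q_+)+h\bigr)$, $G_4=\lfloor Z_Qg_4/u_5\rfloor$. Subroutine $\mathsf H(m)$ (Hamming weight, default form): $a=2m$, $L=2^a$, $\alpha=\lfloor(L+1)^a/L^m\rfloor\bmod L$, $e=a$, $\Pi=L$,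 $\gamma=\alpha\Pi$, $g=\Bigl(\Bigl\lfloor\frac{2^{\gamma(\gamma+\alpha+\Pi)}}{(2^{\gamma\alpha}\mathbin{\dot{-}}1)(2^{\gamma\Pi}\mathbin{\dot{-}}1)}\Bigr\rfloor\bmod2^\gamma\Bigr)\mathbin{\dot{-}}1$, $u=\Pi\mathbin{\dot{-}}1$, output $\lfloor(g^e\bmod u^2)/u\rfloor$. Subroutine $\mathsf R(d,A,B)$: $V_B=d(BB)$, $c=(AA\mathbin{\dot{-}}A)\mathbin{\dot{-}}V_B$, $V_c=cc$, $D_c=V_c\mathbin{\dot{-}}V_B$; it returns the pair $\bigl(\lfloor(V_c+V_B)/D_c\rfloor,\ \lfloor(2B)c/D_c\rfloor\bigr)$. Program QC, with input $d,K,w$ (local variables of subroutines are separate): QC1. $t=K\mathbin{\dot{-}}1$, $P=2^w$, $P_-=P\mathbin{\dot{-}}1$, $q=PP$, $q_1=q^K$, $q_2=q_1^K$, $q_3=q_2^K$, $Q_x=q_1q_2$, $Q_y=q(q_3q_3)$. QC2. $(U_0,U_2,U_4)=\mathsf G_{024}(Q_x,K,t)$, $(V_0,V_2,V_4)=\mathsf G_{024}(Q_y,K,t)$, $d_2=dd$, $D_2=dV_2$, $T_q=P_-\bigl[\bigl(V_0(PU_0\mathbin{\dot{-}}U_4)+2U_2(V_0+D_2)\bigr)\mathbin{\dot{-}}U_0(2D_2+d_2V_4)\bigr]$. QC3. $M=\lfloor T_q/(q_2\mathbin{\dot{-}}1)\rfloor$ (the packed integer), $H_M=\mathsf H(M)$,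 $C=2K$, $\sigma=\lfloor(KK)t/2\rfloor$, $C_+=C+1$, $W_C=C_+\sigma$, $R_C=\lfloor H_M/w\rfloor\mathbin{\dot{-}}W_C$, $A=R_C\bmod C$, $B=\lfloor R_C/C\rfloor$. QC4. Return $\mathsf R(d,A,B)$. *)

(* Defs.v *)
From mathcomp Require Import all_boot.

Set Implicit Arguments.
Unset Strict Implicit.
Unset Printing Implicit Defensive.

(* (x, y) is the solution of x^2 - d y^2 = 1 in positive integers with x
   least.                                                                    *)
Definition pell_solution (d x y : nat) : Prop :=
  [/\ 0 < x, 0 < y & x ^ 2 = d * y ^ 2 + 1].

Definition fundamental_solution (d x y : nat) : Prop :=
  pell_solution d x y /\ forall x' y', pell_solution d x' y' -> x <= x'.

Definition nonsquare (d : nat) : Prop := forall r, d <> r ^ 2.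

(* Number of digits of the binary numeral of n; the numeral of 0 is "0", with
   one digit.                                                                *)
Definition binary_digits (n : nat) : nat := (trunc_log 2 n).+1.

(* Right-hand sides of assignments.  They are kept as syntax so that the
   values of all subexpressions can be listed.  Literals and the current
   values of variables are both injected by [Val].                           *)
Inductive expr : Type :=
| Val of nat
| Add of expr & expr
| Monus of expr & expr
| Mul of expr & expr
| Quo of expr & expr
| Rem of expr & expr
| Pow of expr & expr.

Coercion Val : nat >-> expr.

Declare Scope expr_scope.
Delimit Scope expr_scope with X.
Bind Scope expr_scope with expr.
Notation "x + y" := (Add x y) : expr_scope.
Notation "x - y" := (Monus x y) : expr_scope.
Notation "x * y" := (Mul x y) : expr_scope.
Notation "x %/ y" := (Quo x y) : expr_scope.
Notation "x %% y" := (Rem x y) : expr_scope.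
Notation "x ^ y" := (Pow x y) : expr_scope.

Fixpoint eval (e : expr) : nat :=
  match e with
  | Val n => n
  | Add x y => eval x + eval y
  | Monus x y => eval x - eval y
  | Mul x y => eval x * eval y
  | Quo x y => eval x %/ eval y
  | Rem x y => eval x %% eval y
  | Pow x y => eval x ^ eval y
  end.

(* [%/] and [%%] are total in the library, whereas the programs may only
   divide by positive numbers.                                               *)
Fixpoint divisors_positive (e : expr) : bool :=
  match e with
  | Val _ => true
  | Quo x y | Rem x y =>
      [&& divisors_positive x, divisors_positive y & 0 < eval y]
  | Add x y | Monus x y | Mul x y | Pow x y =>
      divisors_positive x && divisors_positive y
  end.

(* Values of all subexpressions, operands that are leaves included.          *)
Fixpoint values (e : expr) : seq nat :=
  match e with
  | Val n => [:: n]
  | Add x y | Monus x y | Mul x y | Quo x y | Rem x y | Pow x y =>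
      eval e :: values x ++ values y
  end.

(* A program run: its result, whether all divisors met were positive, and the
   recorded intermediates.                                                   *)
Record run (T : Type) : Type := Run {
  result : T;
  well_defined : bool;
  intermediates : seq nat }.

Definition ret (T : Type) (v : T) : run T := Run v true [::].

Definition compute (e : expr) : run nat :=
  Run (eval e) (divisors_positive e) (values e).

Definition bind (S T : Type) (c : run S) (f : S -> run T) : run T :=
  let r := f (result c) in
  Run (result r) (well_defined c && well_defined r)
      (intermediates c ++ intermediates r).

(* For the Hamming-weight call, whose intermediates are not to be bounded;
   its divisors must still be positive.                                      *)
Definition unrecorded (T : Type) (c : run T) : run T :=
  Run (result c) (well_defined c) [::].

Definition returns (T : Type) (c : run T) (v : T) : Prop :=
  well_defined c /\ result c = v.

Notation "'set!' x := e 'in' k" := (bind (compute e%X) (fun x : nat => k))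
  (at level 200, x name, e at level 100, k at level 200,
   format "'[v' 'set!'  x  :=  e  'in' '/' k ']'").
Notation "'call!' p := c 'in' k" := (bind c (fun p => k))
  (at level 200, p strict pattern, c at level 100, k at level 200,
   format "'[v' 'call!'  p  :=  c  'in' '/' k ']'").

Definition G024 (Q K t : nat) : run (nat * nat * nat) :=
  set! u := Q - 1 in
  set! ZQ := Q ^ K in
  set! v := u * t in
  set! Qp := Q + 1 in
  set! u3 := u ^ 3 in
  set! G0 := ZQ %/ u in
  set! z := v - 2 in
  set! g2 := v * z + Qp in
  set! G2 := (ZQ * g2) %/ u3 in
  set! u5 := u ^ 5 in
  set! h := Qp * (Q + 9) in
  set! g4 := g2 * g2 + Q * ((4 * v) * (z - Qp) + h) in
  set! G4 := (ZQ * g4) %/ u5 in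
  ret (G0, G2, G4).

(* Hamming weight.                                                           *)
Definition Hsub (m : nat) : run nat :=
  set! a := 2 * m in
  set! L := 2 ^ a in
  set! alpha := ((L + 1) ^ a %/ L ^ m) %% L in
  set! e := a in
  set! Pi := L in
  set! gamma := alpha * Pi in
  set! g := ((2 ^ (gamma * (gamma + alpha + Pi))
                %/ ((2 ^ (gamma * alpha) - 1) * (2 ^ (gamma * Pi) - 1)))
             %% 2 ^ gamma) - 1 in
  set! u := Pi - 1 in
  set! out := (g ^ e %% u ^ 2) %/ u in
  ret out.

Definition Rsub (d A B : nat) : run (nat * nat) :=
  set! VB := d * (B * B) in
  set! c := (A * A - A) - VB in
  set! Vc := c * c in
  set! Dc := Vc - VB in
  set! x := (Vc + VB) %/ Dc in
  set! y := ((2 * B) * c) %/ Dc in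
  ret (x, y).

(* The steps of the program up to the packed integer M; t is passed on since
   the remaining steps use it.                                               *)
Definition QC_pack (d K w : nat) : run (nat * nat) :=
  set! t := K - 1 in
  set! P := 2 ^ w in
  set! Pm := P - 1 in
  set! q := P * P in
  set! q1 := q ^ K in
  set! q2 := q1 ^ K in
  set! q3 := q2 ^ K in
  set! Qx := q1 * q2 in
  set! Qy := q * (q3 * q3) in
  call! (U0, U2, U4) := G024 Qx K t in
  call! (V0, V2, V4) := G024 Qy K t in
  set! d2 := d * d in
  set! D2 := d * V2 in
  set! Tq := Pm * ((V0 * (P * U0 - U4) + (2 * U2) * (V0 + D2))
                   - U0 * (2 * D2 + d2 * V4)) in
  set! M := Tq %/ (q2 - 1) in
  ret (t, M).

Definition QC (d K w : nat) : run (nat * nat) :=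
  call! (t, M) := QC_pack d K w in
  call! HM := unrecorded (Hsub M) in
  set! C := 2 * K in
  set! sigma := ((K * K) * t) %/ 2 in
  set! Cp := C + 1 in
  set! WC := Cp * sigma in
  set! RC := HM %/ w - WC in
  set! A := RC %% C in
  set! B := RC %/ C in
  Rsub d A B.

Definition packed_integer (d K w : nat) : nat := (result (QC_pack d K w)).2.

(* Main.v *)
Require Import Defs.
From mathcomp Require Import all_boot.
From mathcomp Require Import all_algebra.
From mathcomp Require Import zify ring.

(** Put [P = 2 ^ w].  To each pair [(x, y)] of numbers below [K] the program attaches
    the number [(P - 1) * (P + 1 - s)], where [s] is the square of
    [x ^ 2 - d * y ^ 2 - 1].  As [s <= P], this fits into [2 * w] bits, and its Hamming
    weight is [w] unless [s = 0], in which case it is [2 * w] ([pell_digit_hamming]):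
    the weight detects the solutions of Pell's equation.

    The sum of these numbers with weights [Qx ^ x * Qy ^ y] is a polynomial
    expression in the sums of [j ^ r * Q ^ j] for [r = 0, 2, 4]
    ([pell_polynomial_sum]), each of which is one quotient with a small remainder
    ([quo_power_sum2], [quo_power_sum4]).  Dividing by [q2 - 1] replaces
    each number by [x + 2 * K * y] copies of itself at disjoint places
    ([replicated_quotient]).  So the Hamming weight of the packed integer is [w]
    times the sum of a known constant and of [x + 2 * K * y] over the solutions
    with [x < K] ([packed_hamming]).  The subroutine for the Hamming weight is
    right by Kummer's theorem: the weight of [m] is the 2-adic valuation of the
    central binomial coefficient of [2 * m], which a gcd formula extracts
    ([Hsub_correct]).

    The solutions in question are the powers of [eps = X1 + Y1 sqrt d] up to some
    exponent [n >= 1] ([pell_sum]).  The first coordinates at least double each time,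
    so their sum [A] is below [2 * K] and can be read off modulo [2 * K]; the quotient
    is the sum [B] of the second coordinates.  Then [A + B sqrt d] is a geometric sum, and
    [eps] is a rational function of it ([Rsub_correct]).

    The size bounds follow the program expression by expression, in multiples of
    [w * K ^ 4]; only the powers with a variable exponent need a
    separate bound. *)

Set Implicit Arguments.
Unset Strict Implicit.
Unset Printing Implicit Defensive.

(** * Digits and the Hamming weight *)

Lemma digits_lt b n (f : nat -> nat) :
  (forall i, i < n -> f i < b) -> \sum_(i < n) f i * b ^ i < b ^ n.
Proof.
elim: n => [|n IHn] ltfb; first by rewrite big_ord0.
rewrite big_ord_recr /= expnS.
have := IHn (fun i lt_in => ltfb i (ltnW lt_in)); have := ltfb n (ltnSn n).
set S := \sum_(_ < n) _; nia.
Qed.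

(** The positions from [n] on carry only zero bits, because [n < 2 ^ n]; cutting
    the sum at [n] therefore loses nothing and spares a separate length argument. *)
Definition hamming_weight (n : nat) : nat := \sum_(i < n) odd (n %/ 2 ^ i).

Lemma hamming_weight_wide n k :
  n <= k -> hamming_weight n = \sum_(i < k) odd (n %/ 2 ^ i).
Proof.
move=> le_nk; rewrite /hamming_weight.
rewrite (big_ord_widen _ (fun i => odd (n %/ 2 ^ i) : nat) le_nk).
rewrite big_mkcond; apply: eq_bigr => i _; case: ltnP => // le_ni.
by rewrite divn_small // (leq_ltn_trans le_ni) // ltn_expl.
Qed.

Lemma hamming_weight0 : hamming_weight 0 = 0.
Proof. by rewrite /hamming_weight big_ord0. Qed.

Lemma hamming_weight_bit (e : bool) n :
  hamming_weight (e + n.*2) = e + hamming_weight n.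
Proof.
rewrite (@hamming_weight_wide _ (e + n.*2).+1) // big_ord_recl /= expn0 divn1.
rewrite oddD odd_double addbF oddb (@hamming_weight_wide n (e + n.*2)); last by lia.
congr (_ + _); apply: eq_bigr => i _; rewrite /bump /= expnS divnMA.
by have -> : (e + n.*2) %/ 2 = n by clear; case: e; lia.
Qed.

Lemma hamming_weight_le n : hamming_weight n <= n.
Proof.
rewrite /hamming_weight -[leqRHS]muln1 -[X in X * _]card_ord -sum_nat_const.
by apply: leq_sum => i _; case: odd.
Qed.

Lemma bit_half n : n = odd n + n./2.*2.
Proof. by rewrite odd_double_half. Qed.

(** Concatenation of bit strings, the mechanism by which the weight of a packed
    integer splits into the weights of its digits. *)
Lemma hamming_weight_cat k a b :
  a < 2 ^ k -> hamming_weight (a + b * 2 ^ k) = hamming_weight a + hamming_weight b.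
Proof.
elim: k a => [|k IHk] a.
  by rewrite expn0 ltnS leqn0 => /eqP->; rewrite muln1 hamming_weight0.
rewrite expnS => lt_a; rewrite {1}(bit_half a).
have -> : odd a + a./2.*2 + b * (2 * 2 ^ k) = odd a + (a./2 + b * 2 ^ k).*2.
  by rewrite -!muln2; ring.
rewrite hamming_weight_bit IHk; last by have := bit_half a; lia.
by rewrite [in RHS](bit_half a) hamming_weight_bit addnA.
Qed.

Lemma hamming_weight_compl k a : a < 2 ^ k ->
  hamming_weight a + hamming_weight (2 ^ k - 1 - a) = k.
Proof.
elim: k a => [|k IHk] a.
  by rewrite expn0 ltnS leqn0 => /eqP->; rewrite hamming_weight0.
rewrite expnS => lt_a.
have -> : 2 * 2 ^ k - 1 - a = ~~ odd a + (2 ^ k - 1 - a./2).*2.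
  by have := bit_half a; case: odd; lia.
rewrite {1}(bit_half a) !hamming_weight_bit addnACA IHk; last by have := bit_half a; lia.
by case: odd.
Qed.

Lemma hamming_weight_ones k : hamming_weight (2 ^ k - 1) = k.
Proof.
by have := @hamming_weight_compl k 0; rewrite hamming_weight0 subn0 expn_gt0; apply.
Qed.

Lemma hamming_weight_digits k n (f : nat -> nat) :
  (forall i, i < n -> f i < 2 ^ k) ->
  hamming_weight (\sum_(i < n) f i * (2 ^ k) ^ i) = \sum_(i < n) hamming_weight (f i).
Proof.
elim: n => [|n IHn] ltf; first by rewrite !big_ord0 hamming_weight0.
have ltf' i : i < n -> f i < 2 ^ k by move=> lt_in; apply/ltf/ltnW.
rewrite !big_ord_recr /= -(IHn ltf') -expnM hamming_weight_cat // expnM.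
exact: digits_lt.
Qed.

(** Legendre's formula at 2.  Halving [n] peels off the last bit: the even factors
    of [n!] contribute [n./2] twos and a copy of [(n./2)!]. *)
Lemma logn2_fact n : logn 2 n`! + hamming_weight n = n.
Proof.
have [m] := ubnP n; elim: m n => // m IHm [|n] lt_nm.
  by rewrite hamming_weight0 fact0 logn1.
have e2 k : logn 2 (2 * k)`! = k + logn 2 k`!.
  elim: k => [|k IHk]; first by rewrite muln0 fact0 logn1.
  rewrite mulnS !factS !lognM ?muln_gt0 ?fact_gt0 //= IHk.
  have -> : (2 * k).+2 = 2 * k.+1 by lia.
  rewrite lognM // (@lognE 2 (2 * k).+1) dvdn2 /= oddM /=.
  by rewrite (logn_prime 2 (isT : prime 2)) /=; lia.
have lb (e : bool) k : logn 2 (e + 2 * k)`! = k + logn 2 k`!.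
  rewrite -e2; case: e => //; rewrite add1n factS lognM ?fact_gt0 //.
  by rewrite (@lognE 2 (2 * k).+1) dvdn2 /= oddM.
have := IHm n.+1./2 ltac:(by lia).
have := bit_half n.+1; set e := odd n.+1; set k := n.+1./2 => ->.
rewrite hamming_weight_bit -muln2 mulnC lb; lia.
Qed.

(** Kummer's theorem for the central coefficient: doubling shifts the bits of [m]
    without changing their number, so Legendre's formula for [2m] and twice for
    [m] leaves exactly one copy of the weight. *)
Lemma logn2_central_bin m : logn 2 'C(2 * m, m) = hamming_weight m.
Proof.
have := @bin_fact (2 * m) m ltac:(by lia).
have -> : 2 * m - m = m by lia.
move/(congr1 (logn 2)); rewrite !lognM ?muln_gt0 ?fact_gt0 ?bin_gt0 //; last by lia.
have := logn2_fact m; have := logn2_fact (2 * m).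
have := hamming_weight_bit false m; rewrite add0n -muln2 mulnC /=; lia.
Qed.

(** * The Hamming-weight subroutine *)

Lemma digits_nth b n (f : nat -> nat) j :
  (forall i, i < n -> f i < b) -> j < n ->
  (\sum_(i < n) f i * b ^ i) %/ b ^ j %% b = f j.
Proof.
elim: n => // n IHn ltfb lt_jn.
have b_gt0 : 0 < b by apply: leq_ltn_trans (ltfb n _).
have ltfb' i : i < n -> f i < b by move=> lt_in; apply/ltfb/ltnW.
rewrite big_ord_recr /= addnC; have [lt_j|le_nj] := ltnP j n.
  have -> : f n * b ^ n = f n * b ^ (n - j.+1) * b * b ^ j.
    by rewrite -!mulnA -expnS -expnD; congr (_ * b ^ _); lia.
  by rewrite divnMDl ?expn_gt0 ?b_gt0 // modnMDl IHn.
have -> : j = n by lia.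
rewrite divnMDl ?expn_gt0 ?b_gt0 // divn_small; last exact: digits_lt.
by rewrite addn0 modn_small ?ltfb.
Qed.

Lemma bin_lt_exp2 a i : 0 < a -> 'C(a, i) < 2 ^ a.
Proof.
case: a => // a _; elim: a i => [|a IHa] i; first by case: i => [|[|i]].
case: i => [|i]; first by rewrite bin0 -[1](expn0 2) ltn_exp2l.
by rewrite binS expnS; have := IHa i; have := IHa i.+1; lia.
Qed.

(** By the binomial theorem [(2 ^ a + 1) ^ a] written in base [2 ^ a] has the
    binomial coefficients as digits; none of them overflows, as [bin_lt_exp2] shows. *)
Lemma bin_extract a m : 0 < a -> m <= a ->
  (2 ^ a + 1) ^ a %/ (2 ^ a) ^ m %% 2 ^ a = 'C(a, m).
Proof.
move=> a_gt0 le_ma; rewrite (addnC (2 ^ a)) expnDn.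
under eq_bigr => i _ do rewrite exp1n mul1n.
by apply: (@digits_nth (2 ^ a) a.+1 (fun i => 'C(a, i))) => // i _; apply: bin_lt_exp2.
Qed.

(** With [g] the gcd, [b] divides [a * i] exactly when [b / g] divides [i]; the
    interval from 0 to [b] contains [g] positive such [i], and 0. *)
Lemma gcdn_count a b : 0 < a -> 0 < b ->
  \sum_(i < b.+1) (b %| a * i) = gcdn a b + 1.
Proof.
move=> a_gt0 b_gt0; have g_gt0 : 0 < gcdn a b by rewrite gcdn_gt0 a_gt0.
set g := gcdn a b in g_gt0 *; pose a' := a %/ g; pose b' := b %/ g.
have defa : a = a' * g by rewrite divnK ?dvdn_gcdl.
have defb : b = b' * g by rewrite divnK ?dvdn_gcdr.
have co_ab : coprime b' a'.
  have : g * gcdn b' a' = g by rewrite muln_gcdr ![g * _]mulnC -defa -defb gcdnC.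
  by rewrite -{2}[g]muln1 => /eqP; rewrite eqn_pmul2l.
have b'_gt0 : 0 < b' by move: b_gt0; rewrite {1}defb muln_gt0 => /andP[].
rewrite (eq_bigr (fun i : 'I_b.+1 => (b' %| i) : nat)); last first.
  move=> i _; rewrite {1}defb {1}defa mulnAC dvdn_pmul2r // Gauss_dvdr //.
rewrite -(big_mkord xpredT (fun i => (b' %| i) : nat)) big_ltn // dvdn0.
by rewrite -divn_count_dvd {1}defb mulKn // addnC.
Qed.

(** Division with remainder by [z ^ a - 1]: the expansion of its inverse in
    powers of [z ^ - a], cut off at the last nonnegative exponent. *)
Lemma geom_division z a n : 1 < z -> 0 < a ->
  z ^ (n + a) = (z ^ a - 1) * \sum_(j < (n %/ a).+1) z ^ (n - j * a) + z ^ (n %% a).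
Proof.
move=> z_gt1 a_gt0; set r := n %% a.
have za_gt0 : 0 < z ^ a by rewrite expn_gt0; lia.
suff geom k : z ^ (k * a + r + a)
    = (z ^ a - 1) * \sum_(j < k.+1) z ^ (k * a + r - j * a) + z ^ r.
  by have := geom (n %/ a); rewrite -divn_eq.
elim: k => [|k IHk].
  rewrite big_ord_recr big_ord0 /= mul0n subn0 !add0n expnD; nia.
rewrite big_ord_recl /= mul0n subn0.
under eq_bigr => i _ do rewrite /bump /= add1n !mulSn -addnA subnDl.
have -> : k.+1 * a + r = k * a + r + a by lia.
rewrite expnD mulnDr; move: IHk; set Z := z ^ (_ + r + a).
by set S := \sum_(_ < _) _; nia.
Qed.

(** Modulo [z] only the terms with exponent 0 survive, one for each [i] such that
    [b] divides [a * i]. *)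
Lemma mod_sum_exp z a b : 1 < z -> 0 < a -> 0 < b -> b + 1 < z ->
  (\sum_(i < b.+1) \sum_(j < (a * i %/ b).+1) z ^ (a * i - j * b)) %% z
    = gcdn a b + 1.
Proof.
move=> z_gt1 a_gt0 b_gt0 lt_bz.
rewrite -(gcdn_count a_gt0 b_gt0) -modn_summ.
rewrite (eq_bigr (fun i : 'I_b.+1 => (b %| a * i) : nat)).
  rewrite modn_small // gcdn_count // (leq_ltn_trans _ lt_bz) // leq_add2r.
  by rewrite dvdn_leq // dvdn_gcdr.
move=> i _; set n := a * i.
rewrite big_ord_recr /=.
rewrite -modnDml -modn_summ big1 ?mod0n ?add0n => [|j _]; last first.
  have : 0 < n - j * b by have := ltn_ord j; have := divn_eq n b; nia.
  by case: (n - j * b) => // k _; rewrite expnS modnMr.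
have -> : n - n %/ b * b = n %% b by have := divn_eq n b; lia.
rewrite /dvdn; case: (n %% b) => [|k]; first by rewrite modn_small.
by rewrite expnS modnMr.
Qed.

(** An arithmetic-term formula for the gcd.  Put [z = 2 ^ (a * b)].  Expanding both
    inverses as geometric series, the quotient is the sum of the
    [z ^ (a * i - b * j)] with nonnegative exponent and [i <= b], so that
    its last base-[z] digit counts the solutions of [a * i = b * j] with [i <= b].
    For [a] and [b] greater
    than 1 the discarded tail of the expansion is a proper remainder. *)
Lemma gcdn_formula a b : 1 < a -> 1 < b ->
  2 ^ (a * b * (a * b + a + b))
    %/ ((2 ^ (a * b * a) - 1) * (2 ^ (a * b * b) - 1)) %% 2 ^ (a * b)
  = gcdn a b + 1.
Proof.
move=> a_gt1 b_gt1; rewrite !(expnM _ (a * b)); set z := 2 ^ (a * b).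
have le_bz : 4 ^ b <= z by rewrite -[4]/(2 ^ 2) -expnM leq_exp2l // leq_mul2r a_gt1 orbT.
have lt_b1 : b + 1 <= 2 ^ b by rewrite addn1 ltn_expl.
have e4 : 4 ^ b = 2 ^ b * 2 ^ b by rewrite -expnMn.
have b4 : 4 <= 2 ^ b by rewrite (@leq_exp2l 2 2).
have z_ge : 16 <= z by nia.
have lt_bz : b + 1 < z by nia.
(* [S] is the quotient; [T] collects the remainders of the inner divisions
   by [z ^ b - 1]. *)
pose T := \sum_(i < b.+1) z ^ (a * i %% b).
pose S := \sum_(i < b.+1) \sum_(j < (a * i %/ b).+1) z ^ (a * i - j * b).
have defN : z ^ (a * b + a + b)
    = (z ^ a - 1) * (z ^ b - 1) * S + ((z ^ a - 1) * T + z ^ b).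
  rewrite expnD (@geom_division _ _ (a * b)) //; try lia.
  rewrite modnMr expn0 mulKn; last lia.
  rewrite mulnDl mul1n addnA -!mulnA -mulnDr; congr (_ * _ + _).
  rewrite big_distrl big_distrr -big_split /= (reindex_inj rev_ord_inj).
  apply: eq_bigr => i _; rewrite -expnD /=.
  have -> : a * b - (b.+1 - i.+1) * a = a * i by have := ltn_ord i; nia.
  by rewrite geom_division //; lia.
have z1 : 1 < z by lia.
have leT : 4 * T <= z ^ b.
  have : T <= \sum_(i < b.+1) z ^ b.-1.
    by apply: leq_sum => i _; rewrite leq_exp2l //; have := @ltn_pmod (a * i) b; lia.
  rewrite sum_nat_const card_ord => leT.
  have -> : z ^ b = z * z ^ b.-1 by rewrite -expnS; congr (z ^ _); lia.
  have le_4b : 4 * b.+1 <= z by nia.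
  by apply: leq_trans (leq_mul le_4b (leqnn _)); rewrite -mulnA leq_mul2l leT orbT.
have za : 16 <= z ^ a.
  by apply: leq_trans z_ge _; rewrite -[leqLHS]expn1 leq_exp2l //; lia.
have zb : 16 <= z ^ b.
  by apply: leq_trans z_ge _; rewrite -[leqLHS]expn1 leq_exp2l //; lia.
have lt_rem : (z ^ a - 1) * T + z ^ b < (z ^ a - 1) * (z ^ b - 1).
  have le_W : 4 * ((z ^ a - 1) * T) <= (z ^ a - 1) * z ^ b.
    by rewrite mulnCA leq_mul2l leT orbT.
  move: le_W; set V := _ * T.
  have [W defW] : exists W, z ^ a = W + 16 by exists (z ^ a - 16); rewrite subnK.
  have [Z defZ] : exists Z, z ^ b = Z + 16 by exists (z ^ b - 16); rewrite subnK.
  by rewrite defW defZ -!addnBA //; nia.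
rewrite defN mulnC divnMDl; last by rewrite muln_gt0; lia.
by rewrite divn_small // addn0 mod_sum_exp //; lia.
Qed.

(** Powers of [L] modulo the square of [L - 1] are linear in the exponent:
    [L ^ h = 1 + h * (L - 1)].  This reads off the logarithm of [L ^ h]. *)
Lemma exp_mod_square L h : 2 < L -> h <= L - 2 ->
  L ^ h %% (L - 1) ^ 2 %/ (L - 1) = h.
Proof.
move=> L_gt2 le_h; have [k defk] : exists k, L ^ h = k * (L - 1) ^ 2 + (h * (L - 1) + 1).
  clear le_h; elim: h => [|h [k IHh]]; first by exists 0; rewrite expn0.
  exists (L * k + h); rewrite expnS IHh.
  by have [u ->] : exists u, L = u + 1; [exists (L - 1); lia | rewrite addnK; ring].
rewrite defk modnMDl modn_small; last by nia.
by rewrite divnMDl ?(@divn_small 1) ?addn0 //; lia.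
Qed.

(** The extracted central binomial coefficient [C] has 2-adic valuation the
    Hamming weight [h] of [m] (Kummer), and [h <= 2 * m]; hence its gcd with
    [L = 2 ^ (2 * m)] is [2 ^ h], whose power of exponent [2 * m] is [L ^ h]. *)
Lemma Hsub_correct m : 0 < m -> returns (Hsub m) (hamming_weight m).
Proof.
move=> m_gt0; rewrite /returns /Hsub /=.
have a_gt0 : 0 < 2 * m by lia.
rewrite bin_extract //; last by lia.
set a := 2 * m in a_gt0 *; set L := 2 ^ a; set C := 'C(a, m).
have L_ge : 4 <= L by rewrite (@leq_exp2l 2 2) // /a; lia.
have lt_aL : a < L by apply: ltn_expl.
have lt_CL : C < L by apply: bin_lt_exp2.
have C_gt1 : 1 < C.
  rewrite /C /a; case: (m) m_gt0 => // k _; rewrite mulnS binS.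
  by have := @bin_gt0 (2 * k).+1 k.+1; have := @bin_gt0 (2 * k).+1 k; lia.
have C_gt0 : 0 < C by lia.
have defg : gcdn C L = 2 ^ hamming_weight m.
  have : 2.-nat (gcdn C L) by apply: pnat_dvd (dvdn_gcdr _ _) _; rewrite pnatX.
  move/part_pnat_id => <-; rewrite p_part logn_gcd ?expn_gt0 //.
  rewrite lognX (@logn_prime 2 2) //= muln1.
  rewrite (_ : logn 2 C = hamming_weight m); last exact: logn2_central_bin.
  congr (2 ^ _); apply/minn_idPl.
  by have := hamming_weight_le m; rewrite /a; lia.
rewrite gcdn_formula //; last by lia.
have -> : gcdn C L + 1 - 1 = 2 ^ hamming_weight m by rewrite addnK.
have -> : (2 ^ hamming_weight m) ^ a = L ^ hamming_weight m by rewrite -!expnM mulnC.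
rewrite exp_mod_square; [split=> // | by lia | by have := hamming_weight_le m; lia].
have gt1 k : 0 < k -> 0 < 2 ^ k - 1.
  by case: k => // k _; rewrite subn_gt0 (@ltn_exp2l 2 0).
by rewrite !expn_gt0 !muln_gt0 !gt1 ?muln_gt0 ?expn_gt0 //; lia.
Qed.

(** * Power sums as quotients *)

Definition power_sum (r Q K : nat) : nat := \sum_(j < K) j ^ r * Q ^ j.

Section PowerSumRing.
Import GRing.Theory.
Local Open Scope ring_scope.
Variable R : comNzRingType.
Implicit Types Q : R.

(** The polynomials that the subroutine computes as [g2] and [g4], with genuine
    subtraction in place of truncated subtraction. *)
Definition g2poly Q (t : R) : R :=
  let v := (Q - 1) * t in v * (v - 2) + (Q + 1).
Definition g4poly Q (t : R) : R :=
  let v := (Q - 1) * t in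
  g2poly Q t ^+ 2 + Q * (4 * v * (v - 2 - (Q + 1)) + (Q + 1) * (Q + 9)).

(** For a real [Q > 1] the sum of [j ^ 2 * Q ^ j] over all integers [j <= t], negative
    ones included, is [Q ^ (t + 1) * g2 / (Q - 1) ^ 3], and the negative ones contribute
    [Q * (Q + 1) / (Q - 1) ^ 3].  Clearing the denominator leaves a polynomial identity. *)
Lemma power_sum2_ring Q t :
  Q ^+ t.+1 * g2poly Q t%:R
    = (Q - 1) ^+ 3 * (\sum_(j < t.+1) j%:R ^+ 2 * Q ^+ j) + Q * (Q + 1).
Proof.
elim: t => [|t IHt]; first by rewrite big_ord_recr big_ord0 /g2poly /=; ring.
rewrite big_ord_recr [in RHS]mulrDr [in RHS]addrAC -IHt /g2poly -(natr1 t) !exprS; ring.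
Qed.

(** As for [power_sum2_ring]; the constant comes from the Eulerian polynomial of
    degree 4. *)
Lemma power_sum4_ring Q t :
  Q ^+ t.+1 * g4poly Q t%:R
    = (Q - 1) ^+ 5 * (\sum_(j < t.+1) j%:R ^+ 4 * Q ^+ j)
      + Q * (Q + 1) * (Q ^+ 2 + 10 * Q + 1).
Proof.
elim: t => [|t IHt].
  by rewrite big_ord_recr big_ord0 /g4poly /g2poly /=; ring.
rewrite big_ord_recr [in RHS]mulrDr [in RHS]addrAC -IHt.
rewrite /g4poly /g2poly -(natr1 t) !exprS; ring.
Qed.

End PowerSumRing.

Lemma natr_power_sum (R : comNzRingType) r Q K :
  ((power_sum r Q K)%:R = \sum_(j < K) j%:R ^+ r * Q%:R ^+ j :> R)%R.
Proof.
by rewrite GRing.natr_sum; apply: eq_bigr => j _; rewrite GRing.natrM !GRing.natrX.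
Qed.

(** The remainder is 1, hence the condition [1 < Q - 1]. *)
Lemma quo_power_sum0 Q K : 2 < Q -> Q ^ K %/ (Q - 1) = power_sum 0 Q K.
Proof.
move=> Q_gt2; have -> : Q ^ K = power_sum 0 Q K * (Q - 1) + 1.
  elim: K => [|K IHK]; first by rewrite /power_sum big_ord0.
  rewrite /power_sum big_ord_recr /= -/(power_sum 0 Q K) expnS expn0 mul1n; nia.
by rewrite divnMDl ?divn_small ?addn0; lia.
Qed.

Lemma remainder2_lt Q : 8 <= Q -> Q * (Q + 1) < (Q - 1) ^ 3.
Proof.
move=> Q_ge8; rewrite -(subnK Q_ge8) -addnBA //; move: (Q - 8) => s.
rewrite (_ : (s + (8 - 1)) ^ 3 = (s + 8) * (s + 8 + 1)
   + (s ^ 3 + 20 * s ^ 2 + 130 * s + 271)); last by rewrite (_ : 8 - 1 = 7) //; ring.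
by rewrite -addn1 leq_add2l addn_gt0 orbT.
Qed.

Lemma remainder4_lt Q :
  8 <= Q -> Q * (Q + 1) * (Q ^ 2 + 10 * Q + 1) < (Q - 1) ^ 5.
Proof.
move=> Q_ge8; rewrite -(subnK Q_ge8) -addnBA //; move: (Q - 8) => s.
rewrite (_ : (s + (8 - 1)) ^ 5 =
   (s + 8) * (s + 8 + 1) * ((s + 8) ^ 2 + 10 * (s + 8) + 1)
   + (s ^ 5 + 34 * s ^ 4 + 447 * s ^ 3 + 2771 * s ^ 2 + 7668 * s + 6367)); last first.
  by rewrite (_ : 8 - 1 = 7) //; ring.
by rewrite -addn1 leq_add2l addn_gt0 orbT.
Qed.

Section PowerSumNat.
Import GRing.Theory Num.Theory.
Variables Q t : nat.
Hypotheses (t_gt1 : 1 < t) (Q_ge8 : 8 <= Q).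

Let v := (Q - 1) * t.
Let g2 := v * (v - 2) + (Q + 1).
Let g4 := g2 * g2 + Q * (4 * v * (v - 2 - (Q + 1)) + (Q + 1) * (Q + 9)).

(* With [t >= 2] and [Q >= 8] none of the subtractions in [g2] and [g4] is
   truncated. *)
Let le_v : Q + 3 <= v.
Proof. by apply: leq_trans (leq_mul (leqnn _) t_gt1); lia. Qed.

Let g2E : (g2%:R = g2poly Q%:R t%:R :> int)%R.
Proof.
rewrite /g2poly /g2 natrD natrM natrB; last by apply: leq_trans le_v; lia.
by rewrite /v natrM natrB ?natrD //; lia.
Qed.

Let g4E : (g4%:R = g4poly Q%:R t%:R :> int)%R.
Proof.
rewrite /g4poly /g4 natrD natrM g2E natrM natrD natrM.
rewrite natrB; last by rewrite leq_subRL; apply: leq_trans le_v; lia.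
rewrite natrB; last by apply: leq_trans le_v; lia.
rewrite /v !natrM natrB; last by lia.
by rewrite !natrD; ring.
Qed.

Lemma quo_power_sum2 : Q ^ t.+1 * g2 %/ (Q - 1) ^ 3 = power_sum 2 Q t.+1.
Proof.
have -> : Q ^ t.+1 * g2 = power_sum 2 Q t.+1 * (Q - 1) ^ 3 + Q * (Q + 1).
  apply/eqP; rewrite -(eqr_nat int) natrM g2E !(natrD, natrM) !natrX natr_power_sum.
  by rewrite natrB ?power_sum2_ring; [apply/eqP; ring | lia].
rewrite divnMDl ?expn_gt0; last by lia.
by rewrite divn_small ?addn0 ?remainder2_lt.
Qed.

Lemma quo_power_sum4 : Q ^ t.+1 * g4 %/ (Q - 1) ^ 5 = power_sum 4 Q t.+1.
Proof.
have -> : Q ^ t.+1 * g4 =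
    power_sum 4 Q t.+1 * (Q - 1) ^ 5 + Q * (Q + 1) * (Q ^ 2 + 10 * Q + 1).
  apply/eqP; rewrite -(eqr_nat int) natrM g4E !(natrD, natrM) !natrX natr_power_sum.
  by rewrite natrB ?power_sum4_ring; [apply/eqP; ring | lia].
rewrite divnMDl ?expn_gt0; last by lia.
by rewrite divn_small ?addn0 ?remainder4_lt.
Qed.

End PowerSumNat.

(** * Powers of the fundamental solution *)

(** The coordinates of [(X + Y sqrt d) ^ i]. *)
Fixpoint pell_power (d X Y i : nat) : nat * nat :=
  if i is j.+1 then
    let: (x, y) := pell_power d X Y j in (X * x + d * Y * y, Y * x + X * y)
  else (1, 0).

Section PellPowers.
Variables d X Y : nat.
Hypotheses (d_gt0 : 0 < d) (fundXY : fundamental_solution d X Y).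

Local Notation a i := (pell_power d X Y i).1.
Local Notation b i := (pell_power d X Y i).2.

Lemma pell_powerS i :
  (a i.+1 = X * a i + d * Y * b i) * (b i.+1 = Y * a i + X * b i).
Proof. by rewrite /=; case: pell_power. Qed.

Let normXY : X ^ 2 = d * Y ^ 2 + 1. Proof. by case: fundXY => [[]]. Qed.
Let Y_gt0 : 0 < Y. Proof. by case: fundXY => [[]]. Qed.

Lemma fundamental_gt1 : 1 < X.
Proof. by have := normXY; rewrite -!mulnn; case: X => [|[|n]] //; nia. Qed.

Let X_gt1 := fundamental_gt1.

Lemma pell_power_norm i : a i ^ 2 = d * b i ^ 2 + 1.
Proof.
elim: i => [|i IHi]; first by rewrite muln0.
rewrite !pell_powerS.
have -> : (X * a i + d * Y * b i) ^ 2
    = X ^ 2 * a i ^ 2 + 2 * d * X * Y * a i * b i + d * Y ^ 2 * (d * b i ^ 2) by ring.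
have -> : (Y * a i + X * b i) ^ 2
    = Y ^ 2 * a i ^ 2 + 2 * X * Y * a i * b i + X ^ 2 * b i ^ 2 by ring.
by rewrite IHi normXY; ring.
Qed.

Lemma pell_power_double i : 2 * a i <= a i.+1.
Proof. by rewrite pell_powerS; have := leq_mul X_gt1 (leqnn (a i)); lia. Qed.

Lemma pell_power_gt i : i < a i.
Proof. by elim: i => // i IHi; have := pell_power_double i; lia. Qed.

Lemma pell_power_lt i j : i < j -> a i < a j.
Proof.
elim: j => // j IHj; rewrite ltnS leq_eqVlt => /predU1P[->|/IHj lt_ij].
  by have := pell_power_double j; have := pell_power_gt j; lia.
by have := pell_power_double j; lia.
Qed.

Lemma pell_power_inj i j : a i = a j -> i = j.
Proof. by case: (ltngtP i j) => // /pell_power_lt; lia. Qed.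

Lemma pell_lt x y : x ^ 2 = d * y ^ 2 + 1 -> y < x.
Proof.
move=> norm_xy; rewrite -ltn_sqr norm_xy addn1 ltnS.
by rewrite -[leqLHS]mul1n leq_mul.
Qed.

(** Division by the fundamental unit: [(x', y')] has coordinates
    [X * x - d * Y * y] and [X * y - Y * x].  Minimality of [X] gives [X <= x], hence
    [Y <= y], and this is what makes the second coordinate nonnegative. *)
Lemma pell_descent x y : 0 < y -> x ^ 2 = d * y ^ 2 + 1 ->
  exists x' y', [/\ x = X * x' + d * Y * y', y = Y * x' + X * y',
                    x' ^ 2 = d * y' ^ 2 + 1 & x' < x].
Proof.
move=> y_gt0 norm_xy; have x_gt0 : 0 < x by have := pell_lt norm_xy; lia.
have leXx : X <= x by case: fundXY => _ /(_ x y); apply.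
have leYy : Y <= y.
  have := leXx; rewrite -leq_sqr normXY norm_xy leq_add2r leq_pmul2l //.
  by rewrite leq_sqr.
have le_y : Y * x <= X * y.
  rewrite -leq_sqr !expnMn normXY norm_xy mulnDl mulnDr mul1n muln1.
  by rewrite leq_add ?leq_sqr // mulnCA mulnA.
have le_x : d * Y * y <= X * x.
  rewrite -leq_sqr !expnMn normXY norm_xy.
  have -> : d ^ 2 * Y ^ 2 * y ^ 2 = d * Y ^ 2 * (d * y ^ 2) by ring.
  by rewrite leq_mul // leq_addr.
have [x' defx'] : exists x', X * x = x' + d * Y * y.
  by exists (X * x - d * Y * y); rewrite subnK.
have [y' defy'] : exists y', X * y = y' + Y * x.
  by exists (X * y - Y * x); rewrite subnK.
exists x', y'.
have defx : x = X * x' + d * Y * y'.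
  apply/eqP; rewrite -(eqn_add2r (d * Y ^ 2 * x + d * X * Y * y)); apply/eqP.
  transitivity ((d * Y ^ 2 + 1) * x + d * X * Y * y); first by ring.
  rewrite -normXY; transitivity (X * (X * x) + d * Y * (X * y)); first by ring.
  by rewrite defx' defy'; ring.
have defy : y = Y * x' + X * y'.
  apply/eqP; rewrite -(eqn_add2r (d * Y ^ 2 * y + X * Y * x)); apply/eqP.
  transitivity ((d * Y ^ 2 + 1) * y + X * Y * x); first by ring.
  rewrite -normXY; transitivity (X * (X * y) + Y * (X * x)); first by ring.
  by rewrite defx' defy'; ring.
have norm' : x' ^ 2 = d * y' ^ 2 + 1.
  have eM : 2 * d * X * Y * x' * y' + X ^ 2 * x' ^ 2 + d ^ 2 * Y ^ 2 * y' ^ 2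
          = 2 * d * X * Y * x' * y' + d * Y ^ 2 * x' ^ 2 + d * X ^ 2 * y' ^ 2 + 1.
    transitivity ((X * x' + d * Y * y') ^ 2); first by ring.
    by rewrite -defx norm_xy {1}defy; ring.
  apply/eqP; rewrite -(eqn_add2l (2 * d * X * Y * x' * y' + d * Y ^ 2 * x' ^ 2
                                  + d ^ 2 * Y ^ 2 * y' ^ 2)); apply/eqP.
  transitivity (2 * d * X * Y * x' * y' + X ^ 2 * x' ^ 2 + d ^ 2 * Y ^ 2 * y' ^ 2).
    by rewrite normXY; ring.
  by rewrite eM normXY; ring.
split=> //; rewrite [ltnRHS]defx.
have : 0 < x' by case: (x') norm' => //; rewrite addn1.
by have := leq_mul X_gt1 (leqnn x'); lia.
Qed.

Lemma pell_complete x y : x ^ 2 = d * y ^ 2 + 1 -> exists i, x = a i /\ y = b i.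
Proof.
have [n] := ubnP x; elim: n x y => // n IHn x [|y] lt_xn norm_xy.
  exists 0; split=> //=; move: norm_xy; rewrite exp0n // muln0 add0n => /eqP.
  by rewrite -[1](exp1n 2) eqn_sqr => /eqP.
have [//|x' [y' [defx defy norm' lt_x']]] := @pell_descent x y.+1 _ norm_xy.
have [|i [ex ey]] := IHn x' y' _ norm'; first by lia.
by exists i.+1; rewrite !pell_powerS -ex -ey.
Qed.

(** The solutions in the box are exactly the powers with index at most [n], without
    repetition because their first coordinates increase strictly. *)
Lemma pell_sum (f : nat -> nat -> nat) K n : a n < K <= a n.+1 ->
  \sum_(x < K) \sum_(y < K) (x ^ 2 == d * y ^ 2 + 1) * f x y
    = \sum_(i < n.+1) f (a i) (b i).
Proof.
move=> /andP[lt_anK le_Kan].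
have lt_aK i : i < n.+1 -> a i < K.
  by rewrite ltnS leq_eqVlt => /predU1P[->|/pell_power_lt] //; lia.
have lt_bK i : i < n.+1 -> b i < K.
  by move/lt_aK; have := pell_lt (pell_power_norm i); lia.
transitivity (\sum_(i < n.+1) \sum_(x < K) \sum_(y < K)
    ((x == a i :> nat) && (y == b i :> nat)) * f x y); last first.
  apply: eq_bigr => i _.
  rewrite (bigD1 (Ordinal (lt_aK i (ltn_ord i)))) //=.
  rewrite [X in _ + X]big1 => [|x]; last first.
    by rewrite -val_eqE /= => /negbTE nx; apply: big1 => y _; rewrite nx.
  rewrite (bigD1 (Ordinal (lt_bK i (ltn_ord i)))) //= big1 => [|y]; last first.
    by rewrite -val_eqE /= => /negbTE ny; rewrite ny andbF.
  by rewrite !eqxx mul1n !addn0.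
rewrite [RHS]exchange_big; apply: eq_bigr => x _ /=.
rewrite [RHS]exchange_big; apply: eq_bigr => y _ /=; rewrite -big_distrl /=; congr (_ * _).
case: eqP => [/pell_complete[i [ex ey]]|not_pell]; last first.
  apply/esym/eqP; rewrite sum_nat_eq0; apply/forall_inP => i _; apply/eqP.
  case: eqP => // ex; case: eqP => // ey.
  by case: not_pell; rewrite ex ey pell_power_norm.
have lt_in : i < n.+1.
  rewrite ltnNge leq_eqVlt; apply/negP => lt_ni; have := ltn_ord x; rewrite ex ltnNge.
  case/predU1P: lt_ni => [<-|/pell_power_lt lt_ni]; rewrite ?le_Kan //.
  by rewrite (leq_trans le_Kan) // ltnW.
rewrite (bigD1 (Ordinal lt_in)) //= ex ey !eqxx big1 // => j.
rewrite -val_eqE /= => /eqP neq_ji; case: eqP => // /pell_power_inj e.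
by case: neq_ji.
Qed.
End PellPowers.

(** * Recovering the fundamental solution from sums of its powers *)

(** Write [eps = X + Y sqrt d] and [S = A + B sqrt d].  The last two hypotheses say
    that [(eps - 1) S = X' + Y' sqrt d - 1], which holds when [S] is the sum of the
    powers of [eps] below [eps ^ n = X' + Y' sqrt d].  Since [eps ^ n] has norm 1,
    taking norms gives
    [(X - 1) c = d Y B] for [c = A ^ 2 - A - d B ^ 2].  Equivalently,
    [eps] is the quotient of [c + B sqrt d] by its conjugate, and the subroutine
    rationalizes this quotient; its denominator [D] satisfies
    [(X - 1) D = 2 d B ^ 2], so it is positive. *)
Lemma Rsub_correct d A B X Y X' Y' :
  0 < d -> 1 < X -> 0 < B -> X ^ 2 = d * Y ^ 2 + 1 -> X' ^ 2 = d * Y' ^ 2 + 1 ->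
  X * A + d * Y * B + 1 = A + X' -> Y * A + X * B = B + Y' ->
  returns (Rsub d A B) (X, Y).
Proof.
case: X => [|p] // d_gt0 p_gt0 B_gt0 normXY norm' eA eB.
have p_pos : 0 < p by [].
have normp : p * (p + 2) = d * (Y * Y) by move: normXY; rewrite -!mulnn; lia.
(* The norm equation, with [p = X - 1] and the subtractions moved across. *)
have ec : p * (A * A) = d * Y * B + p * A + p * (d * (B * B)).
  have eX' : X' = p * A + d * Y * B + 1 by move: eA; rewrite mulSn; lia.
  have eY' : Y' = Y * A + p * B by move: eB; rewrite mulSn; lia.
  move: norm'; rewrite eX' eY' => norm'.
  have lhs : (p * A + d * Y * B + 1) ^ 2
     = p * p * (A * A) + d * (Y * Y) * (d * (B * B))
     + 2 * d * p * Y * A * B + 2 * (p * A + d * Y * B) + 1 by ring.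
  have rhs : d * (Y * A + p * B) ^ 2 + 1
     = d * (Y * Y) * (A * A) + p * p * (d * (B * B))
     + 2 * d * p * Y * A * B + 1 by ring.
  move: norm'; rewrite lhs rhs -normp; lia.
have le_c : A + d * (B * B) <= A * A.
  by rewrite -(leq_pmul2l p_pos) ec; lia.
have [c defc] : exists c, A * A = A + d * (B * B) + c.
  by exists (A * A - (A + d * (B * B))); rewrite subnKC.
have pc : p * c = d * Y * B by move: ec; rewrite defc; lia.
have pcc : p * (c * c) = (p + 2) * (d * (B * B)).
  apply/eqP; rewrite -(eqn_pmul2l p_pos); apply/eqP.
  transitivity ((p * c) * (p * c)); first by ring.
  rewrite pc; transitivity (d * (Y * Y) * (d * (B * B))); first by ring.
  by rewrite -normp; ring.
have lt_D : d * (B * B) < c * c.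
  rewrite -(ltn_pmul2l p_pos) pcc ltn_pmul2r; first by lia.
  by rewrite !muln_gt0 d_gt0 B_gt0.
have [D defD] : exists D, c * c = d * (B * B) + D.
  by exists (c * c - d * (B * B)); rewrite subnKC // ltnW.
have pD : p * D = 2 * (d * (B * B)) by move: pcc; rewrite defD; lia.
have D_gt0 : 0 < D by lia.
have cE : A * A - A - d * (B * B) = c by lia.
have DE : c * c - d * (B * B) = D by lia.
rewrite /returns /Rsub /= cE DE D_gt0; split=> //; congr (_, _).
  rewrite (_ : c * c + _ = p.+1 * D) ?mulnK //.
  apply/eqP; rewrite -(eqn_pmul2l p_pos) mulnDr pcc (mulnCA p p.+1) pD; apply/eqP; ring.
rewrite (_ : 2 * B * c = Y * D) ?mulnK //.
apply/eqP; rewrite -(eqn_pmul2l p_pos) (mulnCA p (2 * B)) pc (mulnCA p Y) pD.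
by apply/eqP; ring.
Qed.

Section PellSums.
Variables d X Y : nat.
Hypotheses (d_gt0 : 0 < d) (fundXY : fundamental_solution d X Y).
Local Notation a i := (pell_power d X Y i).1.
Local Notation b i := (pell_power d X Y i).2.
Local Notation A n := (\sum_(i < n.+1) a i).
Local Notation B n := (\sum_(i < n.+1) b i).

Let sumSA n : A n.+1 = A n + a n.+1. Proof. by rewrite big_ord_recr. Qed.
Let sumSB n : B n.+1 = B n + b n.+1. Proof. by rewrite big_ord_recr. Qed.

(** Each power at least doubles the first coordinate.  Hence for [a n < K] the sum is
    a legitimate digit in base [2 * K]. *)
Lemma pell_sum_lt n : A n < 2 * a n.
Proof.
elim: n => [|n IHn]; first by rewrite big_ord1.
rewrite sumSA; have := pell_power_double d_gt0 fundXY n; lia.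
Qed.

Lemma pell_sum_shift n :
  X * A n + d * Y * B n + 1 = A n + a n.+1 /\ Y * A n + X * B n = B n + b n.+1.
Proof.
elim: n => [|n [IHA IHB]]; first by rewrite !big_ord1 /=; lia.
by rewrite sumSA sumSB !(pell_powerS d X Y n.+1) !mulnDr; split; lia.
Qed.

Lemma pell_sums_recover n : 0 < n -> returns (Rsub d (A n) (B n)) (X, Y).
Proof.
move=> n_gt0; have [eA eB] := pell_sum_shift n.
have [[X_gt0 Y_gt0 normXY] _] := fundXY.
apply: Rsub_correct eA eB => //; first exact: fundamental_gt1 d_gt0 fundXY.
  case: n n_gt0 => // n _; rewrite big_ord_recl big_ord_recl /=; lia.
by exact: pell_power_norm fundXY n.+1.
Qed.

Lemma pell_truncation K : X < K -> exists2 n, 0 < n & a n < K <= a n.+1.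
Proof.
move=> lt_XK; have ex_n : exists n, K <= a n.
  by exists K; apply/ltnW/(pell_power_gt d_gt0 fundXY).
case: (ex_minnP ex_n) => [[|[|n]]] /= le_Ka min_n.
- by have := fundamental_gt1 d_gt0 fundXY; lia.
- by move: le_Ka; rewrite muln1 muln0; lia.
exists n.+1 => //; rewrite le_Ka andbT ltnNge; apply/negP => /min_n; lia.
Qed.
End PellSums.

(** * The packed polynomial *)

(** The square of the integer [x ^ 2 - d * y ^ 2 - 1]: one of the two truncated
    differences vanishes. *)
Definition defect_sqr (d x y : nat) : nat :=
  (x ^ 2 - (d * y ^ 2 + 1) + (d * y ^ 2 + 1 - x ^ 2)) ^ 2.

(** With [P = 2 ^ w], this is a base-[P ^ 2] digit: [P ^ 2 - 1], all ones, at a solution,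
    and [(P - s) * P + (s - 1)] when the squared defect [s] is
    positive and at most [P]. *)
Definition pell_digit (d P x y : nat) : nat := (P - 1) * (P + 1 - defect_sqr d x y).

Lemma defect_sqr_eq0 d x y : (defect_sqr d x y == 0) = (x ^ 2 == d * y ^ 2 + 1).
Proof. by rewrite expn_eq0 andbT addn_eq0 !subn_eq0 eqn_leq. Qed.

Lemma defect_sqrE d x y :
  defect_sqr d x y + 2 * x ^ 2 * (d * y ^ 2 + 1) = x ^ 4 + (d * y ^ 2 + 1) ^ 2.
Proof.
rewrite /defect_sqr (_ : x ^ 4 = (x ^ 2) ^ 2); last by rewrite -expnM.
move: (x ^ 2) (d * y ^ 2 + 1) => m n.
have [le_mn|/ltnW le_nm] := leqP m n.
  by have -> : m - n = 0 by [lia]; rewrite add0n -{2 3}(subnK le_mn); ring.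
by have -> : n - m = 0 by [lia]; rewrite addn0 -{2 3}(subnK le_nm); ring.
Qed.

Lemma defect_sqr_le d K x y : 0 < d -> x < K -> y < K ->
  defect_sqr d x y <= d ^ 2 * K ^ 4.
Proof.
move=> d_gt0 lt_xK lt_yK; rewrite /defect_sqr.
have -> : d ^ 2 * K ^ 4 = (d * K ^ 2) ^ 2 by ring.
rewrite leq_sqr.
have lex : x ^ 2 <= d * K ^ 2.
  by rewrite -[leqLHS]mul1n leq_mul // leq_sqr ltnW.
have ley : d * y ^ 2 + 1 <= d * K ^ 2.
  apply: (@leq_trans (d * (y ^ 2 + 1))); first by lia.
  by rewrite leq_mul2l addn1 ltn_sqr lt_yK orbT.
lia.
Qed.

(** The two halves [P - s] and [s - 1] of the digit at a nonsolution are bitwise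
    complements, so that its weight is [w] whatever [s] is; a solution has [2 * w]. *)
Lemma pell_digit_hamming d w x y : defect_sqr d x y <= 2 ^ w ->
  hamming_weight (pell_digit d (2 ^ w) x y)
    = w * (1 + (x ^ 2 == d * y ^ 2 + 1)).
Proof.
rewrite /pell_digit -defect_sqr_eq0; have P_gt0 : 0 < 2 ^ w by rewrite expn_gt0.
case: (defect_sqr d x y) => [_|a lt_aP] /=.
  rewrite subn0 (_ : _ * _ = 2 ^ (w * 2) - 1) ?hamming_weight_ones //.
  by rewrite expnM -mulnn mulnBl mulnDr; lia.
have -> : (2 ^ w - 1) * (2 ^ w + 1 - a.+1) = a + (2 ^ w - 1 - a) * 2 ^ w.
  have [b defP] : exists b, 2 ^ w = a + b + 1 by exists (2 ^ w - a.+1); lia.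
  have e1 : a + b + 1 - 1 = a + b by lia.
  have e2 : a + b + 1 + 1 - a.+1 = b + 1 by lia.
  have e3 : a + b - a = b by lia.
  by rewrite defP e1 e2 e3; ring.
by rewrite hamming_weight_cat // hamming_weight_compl //; lia.
Qed.

Lemma pell_digit_lt d P x y : 0 < P -> pell_digit d P x y < P * P.
Proof.
move=> P_gt0; apply: (@leq_ltn_trans ((P - 1) * (P + 1))).
  by rewrite leq_mul2l leq_subr orbT.
by case: P P_gt0 => // p _; rewrite subn1 /=; lia.
Qed.

Lemma pell_digit00_lt d P : 1 < P -> pell_digit d P 0 0 + 1 < P * P.
Proof.
case: P => [|[|p]] // _; rewrite /pell_digit (_ : defect_sqr d 0 0 = 1).
  by rewrite addnK subn1 /=; lia.
by rewrite /defect_sqr muln0.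
Qed.

Section DoubleSum.
Variables K Qx Qy : nat.
Let S (f : nat -> nat -> nat) :=
  \sum_(x < K) \sum_(y < K) f x y * (Qx ^ x * Qy ^ y).

Let SD f g : S f + S g = S (fun x y => f x y + g x y).
Proof.
rewrite -big_split; apply: eq_bigr => x _; rewrite -big_split.
by apply: eq_bigr => y _; rewrite mulnDl.
Qed.

Let SM c f : c * S f = S (fun x y => c * f x y).
Proof.
rewrite big_distrr; apply: eq_bigr => x _; rewrite big_distrr.
by apply: eq_bigr => y _; rewrite /= mulnA.
Qed.

Let Sprod (f g : nat -> nat) : (\sum_(x < K) f x * Qx ^ x) * (\sum_(y < K) g y * Qy ^ y)
  = S (fun x y => f x * g y).
Proof.
rewrite big_distrlr; apply: eq_bigr => x _; apply: eq_bigr => y _ /=.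
by rewrite mulnACA.
Qed.

Let U r := power_sum r Qx K.
Let V r := power_sum r Qy K.

(** The products of power sums expand [P + 1 - s] for the squared defect [s], a
    polynomial of degree 4 in [x] and [y].  The terms [2 * d * y ^ 2 + d ^ 2 * y ^ 4],
    with negative sign in that polynomial, are subtracted last; [x ^ 4] is subtracted
    from [P] beforehand, so neither subtraction is truncated. *)
Lemma pell_polynomial_sum d P : 0 < d -> d ^ 2 * K ^ 4 <= P ->
  V 0 * (P * U 0 - U 4) + 2 * U 2 * (V 0 + d * V 2)
    - U 0 * (2 * (d * V 2) + d * d * V 4)
  = \sum_(x < K) \sum_(y < K) (P + 1 - defect_sqr d x y) * (Qx ^ x * Qy ^ y).
Proof.
move=> d_gt0 leP.
have le_x4 x : x < K -> x ^ 4 <= P.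
  move=> lt_xK; apply: leq_trans leP; rewrite -[leqLHS]mul1n leq_mul ?expn_gt0 ?d_gt0 //.
  by rewrite leq_exp2r // ltnW.
have -> : P * U 0 - U 4 = \sum_(x < K) (P - x ^ 4) * Qx ^ x.
  apply/eqP; rewrite -(eqn_add2r (U 4)) subnK.
    rewrite /U /power_sum big_distrr -big_split; apply/eqP/eq_bigr => x _ /=.
    by rewrite -mulnDl subnK ?le_x4 // mul1n.
  rewrite /U /power_sum big_distrr; apply: leq_sum => x _ /=.
  by rewrite mul1n leq_mul2r le_x4 ?orbT.
have DV s : (\sum_(x < K) (P - x ^ 4) * Qx ^ x) * V s
    = S (fun x y => (P - x ^ 4) * y ^ s).
  exact: (Sprod (fun x => P - x ^ 4) (fun y => y ^ s)).
have UV r s : U r * V s = S (fun x y => x ^ r * y ^ s).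
  exact: (Sprod (fun x => x ^ r) (fun y => y ^ s)).
have -> : U 0 * (2 * (d * V 2) + d * d * V 4)
    = 2 * (d * (U 0 * V 2)) + d * d * (U 0 * V 4) by ring.
have -> : 2 * U 2 * (V 0 + d * V 2)
    = 2 * (U 2 * V 0 + d * (U 2 * V 2)) by ring.
rewrite [V 0 * _]mulnC DV !UV !(SM, SD) -/(S (fun x y => P + 1 - defect_sqr d x y)).
set N := S (fun x y => 2 * _ + _); set L := S _.
suff -> : L = S (fun x y => P + 1 - defect_sqr d x y) + N by rewrite addnK.
rewrite /L /N SD; apply: eq_bigr => x _; apply: eq_bigr => y _; congr (_ * _).
rewrite !expn0 !muln1 !mul1n.
have := le_x4 x (ltn_ord x).
have := leq_trans (defect_sqr_le d_gt0 (ltn_ord x) (ltn_ord y)) leP.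
have := defect_sqrE d x y; have -> : y ^ 4 = (y ^ 2) ^ 2 by rewrite -expnM.
move: (defect_sqr d x y) (x ^ 2) (x ^ 4) (y ^ 2) => s X X4 Y.
rewrite -!mulnn; lia.
Qed.

End DoubleSum.

(** * Replication of digits by division *)

Lemma sum_prefix n J (f : nat -> nat) : n <= J ->
  \sum_(j < J) (j < n) * f j = \sum_(j < n) f j.
Proof.
move=> le_nJ; rewrite [RHS](big_ord_widen _ f le_nJ) [RHS]big_mkcond /=.
by apply: eq_bigr => j _; case: ifP; rewrite ?mul1n.
Qed.

Lemma geom_sum b n : 0 < b -> b ^ n = (b - 1) * \sum_(j < n) b ^ j + 1.
Proof.
move=> b_gt0; elim: n => [|n IHn]; first by rewrite big_ord0 muln0.
rewrite big_ord_recr /= mulnDr addnAC -IHn expnS mulnBl mul1n.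
by rewrite subnKC // leq_pmull.
Qed.

(** The number of times that the quotient below repeats the digit of index
    [(x, y)]. *)
Definition copies (K x y : nat) : nat := x + 2 * K * y.

Lemma copies_le K x y : x < K -> y < K -> copies K x y <= (2 * K + 1) * K.
Proof.
move=> lt_xK lt_yK; rewrite addnC mulnDl mul1n.
by rewrite leq_add ?leq_mul // ltnW.
Qed.

Section Replication.
Variables (k K : nat) (F : nat -> nat -> nat).
Let q := 2 ^ k.
Let q1 := q ^ K.
Let q2 := q1 ^ K.
Let J := (2 * K + 1) * K.
Hypothesis F_lt : forall x y, x < K -> y < K -> F x y < q.

Let q1E : q1 = 2 ^ (k * K). Proof. by rewrite expnM. Qed.
Let q2E : q2 = 2 ^ (k * K * K). Proof. by rewrite expnM -q1E. Qed.

Let row (G : nat -> nat -> nat) x := \sum_(y < K) G x y * q ^ y.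
Let block (G : nat -> nat -> nat) := \sum_(x < K) row G x * q1 ^ x.

Let row_lt G x : (forall y, y < K -> G x y < q) -> row G x < q1.
Proof. exact: (@digits_lt q K (G x)). Qed.

Let block_lt G : (forall x y, x < K -> y < K -> G x y < q) -> block G < q2.
Proof.
by move=> G_lt; apply: digits_lt => x lt_x; apply: row_lt => y lt_y; apply: G_lt.
Qed.

Let slice j x y := (j < copies K x y) * F x y.

Let slice_lt j x y : x < K -> y < K -> slice j x y < q.
Proof.
move=> lt_x lt_y; apply: leq_ltn_trans (F_lt lt_x lt_y).
by rewrite /slice; case: (_ < _); rewrite ?mul1n.
Qed.

(** The digit [F x y] occupies the places [K * x + y + K ^ 2 * j] with [j < copies K x y],
    in base [q].  Places of different digits are distinct since they are distinct
    modulo [K ^ 2]; the three nested expansions, in bases [q2], [q1]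
    and [q], express this. *)
Definition replicated : nat := \sum_(j < J) block (slice j) * q2 ^ j.

Lemma replicated_lt : replicated < 2 ^ (k * K * K * J).
Proof.
rewrite expnM -q2E; apply: (@digits_lt q2 J (fun j => block (slice j))) => j _.
by apply: block_lt => x y lt_x lt_y; apply: slice_lt.
Qed.

Lemma replicated_hamming : hamming_weight replicated
  = \sum_(x < K) \sum_(y < K) copies K x y * hamming_weight (F x y).
Proof.
rewrite /replicated q2E.
rewrite (@hamming_weight_digits (k * K * K) J (fun j => block (slice j))) => [|j _];
  last first.
  by rewrite -q2E; apply: block_lt => x y lt_x lt_y; apply: slice_lt.
transitivity (\sum_(j < J) \sum_(x < K) \sum_(y < K) hamming_weight (slice j x y)).
  apply: eq_bigr => j _; rewrite /block q1E.
  rewrite (@hamming_weight_digits (k * K) K (row (slice j))) => [|x lt_x]; last first.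
    by rewrite -q1E; apply: row_lt => y; apply: slice_lt.
  apply: eq_bigr => x _; rewrite (@hamming_weight_digits k K (slice j x)) // => y.
  exact: slice_lt.
rewrite exchange_big; apply: eq_bigr => x _ /=.
rewrite exchange_big; apply: eq_bigr => y _ /=.
under eq_bigr => j _.
  rewrite (_ : hamming_weight _ = (j < copies K x y) * hamming_weight (F x y)); last first.
    by rewrite /slice; case: (_ < _); rewrite ?mul1n ?hamming_weight0.
  over.
by rewrite (sum_prefix (fun=> _)) ?copies_le // sum_nat_const card_ord.
Qed.

Hypotheses (K_gt0 : 0 < K) (F00_lt : F 0 0 + 1 < q).

(** The weight [(q1 * q2) ^ x * (q * q2 ^ (2 * K)) ^ y] is
    [q ^ y * q1 ^ x * q2 ^ copies K x y], and dividing [q2 ^ n] by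
    [q2 - 1] yields [n] shifted copies and remainder 1.  The remainders add up to the
    single block of all the digits, which is less than [q2 - 1] because at least one
    digit, that of [(0, 0)], is not the largest one. *)
Lemma replicated_quotient :
  (\sum_(x < K) \sum_(y < K)
     F x y * ((q1 * q2) ^ x * (q * (q2 ^ K * q2 ^ K)) ^ y)) %/ (q2 - 1)
  = replicated.
Proof.
have q_gt0 : 0 < q by rewrite expn_gt0.
have q2_gt0 : 0 < q2 by rewrite !expn_gt0.
have lt_block : block F < q2 - 1.
  (* Raising the digit of [(0, 0)] by one still leaves a valid expansion. *)
  pose F' x y := F x y + ((x == 0) && (y == 0)).
  have : block F' < q2.
    apply: block_lt => x y lt_x lt_y; rewrite /F'.
    case: x y lt_x lt_y => [|x] [|y] lt_x lt_y; rewrite /= ?addn0; last exact: F_lt.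
    - exact: F00_lt.
    - exact: F_lt.
    - exact: F_lt.
  suff -> : block F' = block F + 1 by rewrite ltn_subRL addnC.
  have unit_digit b : \sum_(i < K) (i == 0 :> nat) * b ^ i = 1.
    rewrite (bigD1 (Ordinal K_gt0)) //= big1 ?addn0 // => i.
    by rewrite -val_eqE /= => /negbTE->.
  rewrite -[in RHS](unit_digit q1) -big_split; apply: eq_bigr => x _ /=.
  rewrite -mulnDl; congr (_ * _); rewrite -[X in _ + X]muln1 -(unit_digit q).
  rewrite big_distrr -big_split; apply: eq_bigr => y _ /=.
  by rewrite /F' mulnDl mulnA mulnb.
have -> : replicated = \sum_(x < K) \sum_(y < K)
    F x y * q ^ y * q1 ^ x * \sum_(j < copies K x y) q2 ^ j.
  transitivity (\sum_(j < J) \sum_(x < K) \sum_(y < K)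
    slice j x y * q ^ y * q1 ^ x * q2 ^ j).
    apply: eq_bigr => j _; rewrite big_distrl; apply: eq_bigr => x _.
    by rewrite !big_distrl.
  rewrite exchange_big; apply: eq_bigr => x _ /=.
  rewrite exchange_big; apply: eq_bigr => y _ /=.
  rewrite -(@sum_prefix _ J (fun j => q2 ^ j)) ?copies_le // big_distrr.
  by apply: eq_bigr => j _; rewrite /slice /=; ring.
rewrite (_ : \sum_(x < K) \sum_(y < K) F x y * ((q1 * q2) ^ x * _)
   = (\sum_(x < K) \sum_(y < K)
        F x y * q ^ y * q1 ^ x * \sum_(j < copies K x y) q2 ^ j) * (q2 - 1) + block F).
  by rewrite divnMDl ?(divn_small lt_block) ?addn0 //; lia.
rewrite big_distrl -big_split; apply: eq_bigr => x _ /=.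
rewrite !big_distrl -big_split; apply: eq_bigr => y _ /=.
have -> : (q1 * q2) ^ x * (q * (q2 ^ K * q2 ^ K)) ^ y
    = q ^ y * q1 ^ x * q2 ^ copies K x y.
  have e : q2 ^ (2 * K * y) = (q2 ^ K) ^ y * (q2 ^ K) ^ y.
    by rewrite -expnMn -expnD addnn -mul2n expnM.
  by rewrite /copies !expnMn expnD e; ring.
by rewrite (geom_sum (copies K x y) q2_gt0); ring.
Qed.
End Replication.

Lemma sum_copies K :
  \sum_(x < K) \sum_(y < K) copies K x y = (2 * K + 1) * (K * K * (K - 1) %/ 2).
Proof.
have triangle n : 2 * \sum_(i < n) i = n * (n - 1).
  elim: n => [|n IHn]; first by rewrite big_ord0.
  by rewrite big_ord_recr mulnDr IHn /=; case: (n) => // m; rewrite !subn1 /=; lia.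
have -> : K * K * (K - 1) = K * (\sum_(i < K) i) * 2.
  by rewrite -mulnA -triangle; ring.
rewrite mulnK // /copies; under eq_bigr => x _.
  rewrite big_split sum_nat_const card_ord -big_distrr /=.
  over.
rewrite big_split sum_nat_const card_ord -big_distrr /=; ring.
Qed.

(** * Specifications of runs and sizes of values *)

Section Runs.
Variable I : nat -> Prop.

Definition bounded (T : Type) (r : run T) : Prop :=
  forall v, v \in intermediates r -> I v.

(** A Hoare-style specification: along a run the computed values stay variables
    known only by their postconditions, which keeps the terms small although the
    semantics substitutes every value for its variable. *)
Definition run_spec (T : Type) (r : run T) (post : T -> Prop) : Prop :=
  [/\ well_defined r, post (result r) & bounded r].

Fixpoint values_satisfy (e : expr) : Prop :=
  match e with
  | Val n => I n
  | Add x y | Monus x y | Mul x y | Quo x y | Rem x y | Pow x y =>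
      [/\ I (eval e), values_satisfy x & values_satisfy y]
  end.

Lemma values_satisfyP e : values_satisfy e -> forall v, v \in values e -> I v.
Proof.
elim: e => [n|x IHx y IHy|x IHx y IHy|x IHx y IHy|x IHx y IHy|x IHx y IHy|x IHx y IHy];
  first by move=> In v; rewrite /= mem_seq1 => /eqP->.
all: case=> Ie Ix Iy v; rewrite /= inE mem_cat.
all: by case/predU1P=> [->|/orP[/IHx|/IHy]]; auto.
Qed.

Lemma bounded_bind S T (c : run S) (f : S -> run T) :
  bounded c -> bounded (f (result c)) -> bounded (bind c f).
Proof. by move=> bc bf v; rewrite mem_cat => /orP[/bc|/bf]. Qed.

Lemma bounded_set T e (f : nat -> run T) : values_satisfy e ->
  (forall x, x = eval e -> bounded (f x)) -> bounded (bind (compute e) f).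
Proof. by move=> Ie bf; apply: bounded_bind (bf _ erefl); apply: values_satisfyP. Qed.

Lemma spec_ret T (v : T) (post : T -> Prop) : post v -> run_spec (ret v) post.
Proof. by []. Qed.

Lemma spec_bind S T (c : run S) (f : S -> run T) (mid : S -> Prop) post :
  run_spec c mid -> (forall x, mid x -> run_spec (f x) post) ->
  run_spec (bind c f) post.
Proof.
move=> [wc mc bc] spec_f; have [wf pf bf] := spec_f _ mc.
by split; [rewrite /= wc | | apply: bounded_bind].
Qed.

Lemma spec_set T e (f : nat -> run T) post :
  divisors_positive e -> values_satisfy e ->
  (forall x, x = eval e -> run_spec (f x) post) ->
  run_spec (bind (compute e) f) post.
Proof.
by move=> we Ie; apply: spec_bind; split=> //; apply: values_satisfyP.
Qed.

Lemma spec_unrecorded S T (c : run S) v (f : S -> run T) post :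
  returns c v -> run_spec (f v) post -> run_spec (bind (unrecorded c) f) post.
Proof.
by move=> [wc def_v] spec_f; apply: (@spec_bind _ _ _ _ (eq^~ v)) => // x ->.
Qed.

Lemma spec_returns T (r : run T) v :
  returns r v -> bounded r -> run_spec r (fun x => x = v).
Proof. by case. Qed.

End Runs.

Section Bits.
Variable T : nat.
Hypothesis T_gt0 : 0 < T.

(** The bound is strict and [T] is a unit of length: sizes add up under products
    whatever [T] is, while the carry of an addition costs one more unit. *)
Definition bits (n v : nat) : Prop := v < 2 ^ (n * T).

Lemma bits_le m n v : bits m v -> m <= n -> bits n v.
Proof.
move=> v_lt le_mn; apply: leq_trans v_lt _.
by rewrite leq_exp2l // leq_mul2r le_mn orbT.
Qed.

Lemma bits_leq n u v : bits n v -> u <= v -> bits n u.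
Proof. by move=> v_lt le_uv; apply: leq_ltn_trans v_lt. Qed.

Lemma bitsD m n u v : bits m u -> bits n v -> bits (m + n + 1) (u + v).
Proof.
rewrite /bits !mulnDl mul1n !expnD => lt_u lt_v.
have le2 : 2 ^ 1 <= 2 ^ T by rewrite leq_exp2l.
apply: leq_trans (leq_mul (leqnn _) le2).
have [M_gt0 N_gt0] : 0 < 2 ^ (m * T) /\ 0 < 2 ^ (n * T) by rewrite !expn_gt0.
nia.
Qed.

Lemma bitsM m n u v : bits m u -> bits n v -> bits (m + n) (u * v).
Proof. by rewrite /bits mulnDl expnD => lt_u lt_v; apply: ltn_mul. Qed.

Lemma bitsB m u v : bits m u -> bits m (u - v).
Proof. by move/bits_leq; apply; apply: leq_subr. Qed.

Lemma bits_div m u v : bits m u -> bits m (u %/ v).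
Proof. by move/bits_leq; apply; apply: leq_div. Qed.

Lemma bits_mod m u v : bits m u -> bits m (u %% v).
Proof. by move/bits_leq; apply; apply: leq_mod. Qed.

Lemma bitsX m u n : bits m u -> 0 < n -> bits (m * n) (u ^ n).
Proof.
by rewrite /bits => lt_u n_gt0; rewrite mulnAC expnM ltn_exp2r.
Qed.

Lemma bits_pow2 m n : n < m * T -> bits m (2 ^ n).
Proof. by move=> lt_n; rewrite /bits ltn_exp2l. Qed.

Lemma bits_linear v : v <= T -> bits 1 v.
Proof. by rewrite /bits mul1n => le_v; apply: leq_ltn_trans le_v (ltn_expl _ _). Qed.

Lemma bits_const v : v < 16 -> bits 4 v.
Proof.
by move/leq_trans; apply; rewrite (@leq_exp2l 2 4) // -{1}[4]muln1 leq_mul.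
Qed.

Lemma bits_digits n v : 0 < n -> v < 2 ^ n -> binary_digits v <= n.
Proof.
move=> n_gt0 lt_v; rewrite /binary_digits.
case: v lt_v => [|v] lt_v; first by rewrite trunc_log0.
rewrite -(@ltn_exp2l 2) //; apply: leq_ltn_trans lt_v.
by have /andP[] := @trunc_log_bounds 2 v.+1 isT isT.
Qed.
End Bits.

(* [find_bits] infers a number of units from the shape of an expression, leaving it
   as an existential variable until the leaves are reached; powers with a variable
   exponent must be covered by a hypothesis. *)
Ltac find_bits T0 :=
  lazymatch goal with
  | |- bits _ _ (_ + _) => eapply (bitsD T0); find_bits T0
  | |- bits _ _ (_ * _) => eapply bitsM; find_bits T0
  | |- bits _ _ (_ - _) => eapply bitsB; find_bits T0
  | |- bits _ _ (_ %/ _) => eapply bits_div; find_bits T0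
  | |- bits _ _ (_ %% _) => eapply bits_mod; find_bits T0
  | |- bits _ _ (_ ^ _) => first [eassumption | eapply bitsX; [find_bits T0 | reflexivity]]
  | |- _ => first [eassumption | apply (bits_const T0); reflexivity]
  end.
Ltac bound_bits T0 := eapply bits_le; [find_bits T0 | vm_compute; reflexivity].
Ltac bound_values T0 :=
  rewrite /=; repeat (match goal with |- and3 _ _ _ => split end); bound_bits T0.
Ltac remember_bits T0 x defx :=
  let b := fresh "bits_" x in
  simpl in defx; eassert (b : bits _ _ x); [rewrite defx; find_bits T0 | cbn in b].

(* One assignment: its divisors, the sizes of its subexpressions, then its value,
   which receives a name, a defining equation and a size. *)
Tactic Notation "step" constr(T0) ident(x) "by" tactic(wd) :=
  let defx := fresh "def" x in
  apply: spec_set; [wd; done | bound_values T0 | intros x defx; remember_bits T0 x defx].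
Tactic Notation "step" constr(T0) ident(x) := step T0 x by (vm_compute; reflexivity).

Section Programs.
Variable T : nat.
Hypothesis T_gt0 : 0 < T.

(** With a variable exponent, a size for [Q] yields none for [Q ^ K], so both are
    hypotheses.  The constants here and below are round numbers above the inferred ones. *)
Lemma G024_spec Q t : 1 < t -> 8 <= Q ->
  bits T 1 t -> bits T 1 t.+1 -> bits T 5 Q -> bits T 7 (Q ^ t.+1) ->
  run_spec (bits T 1000) (G024 Q t.+1 t) (fun G =>
    G = (power_sum 0 Q t.+1, power_sum 2 Q t.+1, power_sum 4 Q t.+1) /\
    [/\ bits T 100 G.1.1, bits T 100 G.1.2 & bits T 100 G.2]).
Proof.
move=> t_gt1 Q_ge8 bits_t bits_K bits_Q bits_QK; have Q_gt1 : 0 < Q - 1 by lia.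
step T_gt0 u.
step T_gt0 ZQ.
step T_gt0 v.
step T_gt0 Qp.
step T_gt0 u3.
step T_gt0 G0 by rewrite /= defu.
step T_gt0 z.
step T_gt0 g2.
step T_gt0 G2 by rewrite /= defu3 expn_gt0 defu Q_gt1.
step T_gt0 u5.
step T_gt0 h.
step T_gt0 g4.
step T_gt0 G4 by rewrite /= defu5 expn_gt0 defu Q_gt1.
apply: spec_ret; split; last by split; bound_bits T_gt0.
rewrite defG0 defG2 defG4 defg4 defg2 defh defu5 defu3 defz defv defu defZQ defQp.
by rewrite quo_power_sum0 ?quo_power_sum2 ?quo_power_sum4 //; lia.
Qed.

Lemma Rsub_bounded d A B : bits T 2 d -> bits T 100 A -> bits T 100 B ->
  bounded (bits T 1000) (Rsub d A B).
Proof.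
move=> bits_d bits_A bits_B.
apply: bounded_set => [|V defV]; first by bound_values T_gt0.
remember_bits T_gt0 V defV.
apply: bounded_set => [|c defc]; first by bound_values T_gt0.
remember_bits T_gt0 c defc.
apply: bounded_set => [|Vc defVc]; first by bound_values T_gt0.
remember_bits T_gt0 Vc defVc.
apply: bounded_set => [|Dc defDc]; first by bound_values T_gt0.
remember_bits T_gt0 Dc defDc.
apply: bounded_set => [|x _]; first by bound_values T_gt0.
by apply: bounded_set => [|y _]; first by bound_values T_gt0.
Qed.
End Programs.

Lemma exp2_ge8 n : 2 < n -> 8 <= 2 ^ n.
Proof. by move=> n_gt2; rewrite -[8]/(2 ^ 3) leq_exp2l. Qed.

(** * The program *)

Section Main.
Variables d K w X Y : nat.
Hypotheses (d_gt1 : 1 < d) (fundXY : fundamental_solution d X Y).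
Hypotheses (lt_XK : X < K) (w_gt0 : 0 < w) (le_P : d ^ 2 * K ^ 4 <= 2 ^ w).

Let T := w * K ^ 4.
Let d_gt0 : 0 < d. Proof. exact: ltnW. Qed.
Let K_gt2 : 2 < K. Proof. by have := fundamental_gt1 d_gt0 fundXY; lia. Qed.
Let T_gt0 : 0 < T. Proof. by rewrite muln_gt0 w_gt0 expn_gt0; lia. Qed.
Let le_T i : i <= 4 -> w * K ^ i <= T.
Proof. by move=> le_i4; rewrite leq_mul2l leq_exp2l ?le_i4 ?orbT //; lia. Qed.
Let le_T0 : w <= T. Proof. by have := le_T (isT : 0 <= 4); rewrite muln1. Qed.
Let le_T1 : w * K <= T. Proof. exact: (@le_T 1). Qed.

Let bits_w : bits T 1 w. Proof. exact: bits_linear. Qed.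
Let bits_K : bits T 1 K.
Proof. by apply: bits_linear; apply: leq_trans le_T1; rewrite leq_pmull. Qed.
Let bits_P : bits T 2 (2 ^ w). Proof. by apply: bits_pow2; lia. Qed.
Let bits_d : bits T 2 d.
Proof.
apply: bits_leq bits_P _; apply: leq_trans le_P.
by rewrite -mulnn -mulnA leq_pmulr // muln_gt0 d_gt0 expn_gt0; lia.
Qed.

Let packed := replicated (2 * w) K (pell_digit d (2 ^ w)).

Lemma QC_pack_spec : run_spec (bits T 1000) (QC_pack d K w)
  (fun tM => tM = (K - 1, packed)).
Proof.
have [t defK] : exists t, K = t.+1 by exists K.-1; lia.
have [le2 le3] := (@le_T 2 isT, @le_T 3 isT).
have T_ge : 9 * w <= T.
  by rewrite mulnC leq_mul2l (@leq_trans (3 ^ 4)) ?orbT // leq_exp2r.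
have t_gt1 : 1 < t by rewrite -ltnS -defK.
step T_gt0 t'.
have t'E : t' = t by rewrite deft' defK subn1.
step T_gt0 P.
step T_gt0 Pm.
step T_gt0 q.
have qE : q = 2 ^ (2 * w) by rewrite defq defP -expnD addnn mul2n.
have q1E : q ^ K = 2 ^ (2 * w * K) by rewrite qE -expnM.
have bits_qK : bits T 3 (q ^ K) by rewrite q1E; apply: bits_pow2; lia.
step T_gt0 q1.
have q2E : q1 ^ K = 2 ^ (2 * w * K ^ 2) by rewrite defq1 q1E -expnM -mulnA.
have bits_q1K : bits T 3 (q1 ^ K) by rewrite q2E; apply: bits_pow2; lia.
step T_gt0 q2.
have q3E : q2 ^ K = 2 ^ (2 * w * K ^ 3) by rewrite defq2 q2E -expnM -mulnA -expnSr.
have bits_q2K : bits T 3 (q2 ^ K) by rewrite q3E; apply: bits_pow2; lia.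
step T_gt0 q3.
step T_gt0 Qx.
step T_gt0 Qy.
have QxE : Qx = 2 ^ (2 * w * K + 2 * w * K ^ 2).
  by rewrite defQx defq1 q1E defq2 q2E expnD.
have QyE : Qy = 2 ^ (2 * w + 4 * w * K ^ 3).
  by rewrite defQy defq3 q3E qE -!expnD; congr (2 ^ _); lia.
have bits_Qx' : bits T 5 Qx by rewrite QxE; apply: bits_pow2; lia.
have bits_Qy' : bits T 5 Qy by rewrite QyE; apply: bits_pow2; lia.
have bits_QxK : bits T 7 (Qx ^ K).
  rewrite QxE -expnM; apply: bits_pow2.
  rewrite (_ : _ * K = 2 * (w * K ^ 2) + 2 * (w * K ^ 3)); first by lia.
  by rewrite !expnS; ring.
have bits_QyK : bits T 7 (Qy ^ K).
  rewrite QyE -expnM; apply: bits_pow2.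
  rewrite (_ : _ * K = 2 * (w * K) + 4 * (w * K ^ 4)); first by rewrite -/T; lia.
  by rewrite !expnS; ring.
have wK_gt0 i : 0 < w * K ^ i by rewrite muln_gt0 w_gt0 expn_gt0; lia.
have Qx_ge8 : 8 <= Qx.
  rewrite QxE; apply: exp2_ge8; rewrite -!mulnA; move: (wK_gt0 1) (wK_gt0 2).
  by rewrite expn1; move: (w * K) (w * K ^ 2) => x y; clear; lia.
have Qy_ge8 : 8 <= Qy.
  rewrite QyE; apply: exp2_ge8; rewrite -mulnA; move: (wK_gt0 3).
  by move: (w * K ^ 3) => x; clear -w_gt0; lia.
move: bits_QxK bits_QyK bits_K; rewrite t'E defK => bits_QxK bits_QyK bits_t1.
have bits_t : bits T 1 t by apply: bits_leq bits_t1 _.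
apply: spec_bind (G024_spec T_gt0 t_gt1 Qx_ge8 bits_t bits_t1 bits_Qx' bits_QxK) _ => //.
case=> [[U0 U2] U4] [[U0E U2E U4E] [/= bits_U0 bits_U2 bits_U4]].
apply: spec_bind (G024_spec T_gt0 t_gt1 Qy_ge8 bits_t bits_t1 bits_Qy' bits_QyK) _ => //.
case=> [[V0 V2] V4] [[V0E V2E V4E] [/= bits_V0 bits_V2 bits_V4]].
step T_gt0 d2.
step T_gt0 D2.
step T_gt0 Tq.
have q2_gt1 : 0 < q2 - 1.
  by rewrite defq2 q2E subn_gt0 -{1}(expn0 2) ltn_exp2l // -mulnA muln_gt0 wK_gt0.
step T_gt0 M by rewrite /= q2_gt1.
apply: spec_ret; congr (_, _); first by rewrite subn1.
rewrite defM defTq defD2 defd2 U0E U2E U4E V0E V2E V4E -defK.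
rewrite pell_polynomial_sum //; last by rewrite defP.
rewrite /packed -(@replicated_quotient (2 * w) K (pell_digit d (2 ^ w))).
- rewrite -qE -defq1 -defq2 -defq3 -defQx -defQy big_distrr; congr (_ %/ _).
  apply: eq_bigr => x _; rewrite big_distrr; apply: eq_bigr => y _ /=.
  by rewrite mulnA defPm defP.
- by move=> x y _ _; rewrite mulnC expnM; apply: pell_digit_lt; rewrite expn_gt0.
- exact: ltnW (ltnW K_gt2).
- by rewrite mulnC expnM; apply: pell_digit00_lt; rewrite -{1}(expn0 2) ltn_exp2l.
Qed.

(** Every digit contributes [w] per copy, and a solution another [w]; the first
    contribution is the constant that the program subtracts. *)
Lemma packed_hamming : hamming_weight packed =
  w * ((2 * K + 1) * (K * K * (K - 1) %/ 2)
       + \sum_(x < K) \sum_(y < K) (x ^ 2 == d * y ^ 2 + 1) * (x + 2 * K * y)).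
Proof.
rewrite /packed replicated_hamming; last first.
  by move=> x y _ _; rewrite mulnC expnM; apply: pell_digit_lt; rewrite expn_gt0.
rewrite -sum_copies -big_split big_distrr; apply: eq_bigr => x _ /=.
rewrite -big_split big_distrr; apply: eq_bigr => y _ /=.
rewrite pell_digit_hamming; last first.
  exact: leq_trans (defect_sqr_le d_gt0 (ltn_ord x) (ltn_ord y)) le_P.
by rewrite /copies; ring.
Qed.

Lemma packed_lt : packed < 2 ^ (2 * w * (2 * K + 1) * K ^ 3).
Proof.
have -> : 2 * w * (2 * K + 1) * K ^ 3 = 2 * w * K * K * ((2 * K + 1) * K).
  by rewrite !expnS; ring.
apply: replicated_lt => x y _ _.
by rewrite mulnC expnM; apply: pell_digit_lt; rewrite expn_gt0.
Qed.

Let packed_gt0 : 0 < packed.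
Proof.
have : 0 < hamming_weight packed.
  rewrite packed_hamming muln_gt0 w_gt0 addn_gt0 muln_gt0 divn_gt0 // addn1 /=.
  by rewrite -[2]/(2 * 1 * 1) !leq_mul //; move: K_gt2; clear; lia.
by case: packed => //; rewrite hamming_weight0.
Qed.

Lemma bits_packed : bits T 6 packed.
Proof.
apply: leq_trans packed_lt _; rewrite leq_exp2l //.
have le3 := @le_T 3 isT.
rewrite (_ : _ * K ^ 3 = 4 * T + 2 * (w * K ^ 3)); first by lia.
by rewrite /T !expnS; ring.
Qed.

Lemma QC_spec : run_spec (bits T 1000) (QC d K w) (fun r => r = (X, Y)).
Proof.
apply: spec_bind QC_pack_spec _ => tM ->.
apply: spec_unrecorded (Hsub_correct packed_gt0) _.
have [n n_gt0 n_trunc] := pell_truncation d_gt0 fundXY lt_XK.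
have bits_t : bits T 1 (K - 1) by apply: bitsB.
have bits_HM : bits T 6 (hamming_weight packed).
  exact: bits_leq bits_packed (hamming_weight_le _).
set HM := hamming_weight packed in bits_HM *.
step T_gt0 C.
step T_gt0 sigma.
step T_gt0 Cp.
step T_gt0 WC.
step T_gt0 RC by rewrite /= w_gt0.
have C_gt0 : 0 < C by rewrite defC muln_gt0 (ltnW (ltnW K_gt2)).
step T_gt0 A by rewrite /= C_gt0.
step T_gt0 B by rewrite /= C_gt0.
pose a i := (pell_power d X Y i).1; pose b i := (pell_power d X Y i).2.
(* The base-[2 * K] digits of [RC] are the two coordinate sums. *)
have RCE : RC = (\sum_(i < n.+1) b i) * C + \sum_(i < n.+1) a i.
  rewrite defRC /HM packed_hamming mulKn //.
  rewrite (pell_sum d_gt0 fundXY (fun x y => x + 2 * K * y) n_trunc).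
  rewrite defWC defCp defsigma defC addKn big_split -big_distrr /=.
  by rewrite addnC mulnC.
have lt_A : \sum_(i < n.+1) a i < C.
  apply: leq_trans (pell_sum_lt d_gt0 fundXY n) _; rewrite defC leq_mul2l /=.
  by case/andP: n_trunc => /ltnW.
have AE : A = \sum_(i < n.+1) a i by rewrite defA RCE modnMDl modn_small.
have BE : B = \sum_(i < n.+1) b i by rewrite defB RCE divnMDl // divn_small ?addn0.
apply: spec_returns; first by rewrite AE BE; apply: pell_sums_recover.
by apply: Rsub_bounded => //; bound_bits T_gt0.
Qed.
End Main.

Theorem theorem12 :
  exists c : nat, forall d K w X1 Y1 : nat,
    2 <= d -> nonsquare d -> fundamental_solution d X1 Y1 ->
    X1 < K -> 0 < w -> d ^ 2 * K ^ 4 <= 2 ^ w ->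
    [/\ returns (QC d K w) (X1, Y1),
        binary_digits (packed_integer d K w) <= 2 * w * (2 * K + 1) * K ^ 3
      & forall v : nat, v \in intermediates (QC d K w) ->
          binary_digits v <= c * (w * K ^ 4)].
Proof.
exists 1000 => d K w X Y d_gt1 _ fundXY lt_XK w_gt0 le_P.
have K_gt0 : 0 < K by apply: leq_ltn_trans lt_XK.
have [wd res_XY bnd] := QC_spec d_gt1 fundXY lt_XK w_gt0 le_P.
split=> [//||v /bnd v_lt].
- have [_ def_tM _] := QC_pack_spec d_gt1 fundXY lt_XK w_gt0 le_P.
  rewrite /packed_integer def_tM; apply: bits_digits; last exact: packed_lt.
  by rewrite !muln_gt0 w_gt0 addn1 ?expn_gt0 K_gt0.
- by apply: bits_digits v_lt; rewrite !muln_gt0 w_gt0 ?expn_gt0 ?K_gt0.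
Qed.
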